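(* Fix $k\ge2$. Assume $q_i>0$ for all $i\in\mathbb{N}$ and $\mathbb{E} Z=\infty$. Then, in the $k$-choice model, with probability one, $L_n\to-\infty$ as $n\to\infty$.
   Context: Let $Z$ be a random variable on $\mathbb{N}=\{1,2,3,\dots\}$ with $q_i=\mathbb{P}(Z=i)$. Fix $k\ge2$ and let $(Z^{(1)}_n)_{n\ge1},\dots,(Z^{(k)}_n)_{n\ge1}$ be $k$ independent sequences of i.i.d. random variables, all distributed as $Z$ and mutually independent. The $k$-choice model: define $T_n=\{n\}$ for $n\le0$ and $T_n=\{n\}\cup\bigcup_{i=1}^k T_{n-Z^{(i)}_n}$ for $n\ge1$. Let $\mathcal{L}_n=T_n\cap\{0,-1,-2,\dots\}$, $R_n=\max\mathcal{L}_n$, $L_n=\min\mathcal{L}_n$, $\Lambda_n=|\mathcal{L}_n|$. *)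

(* Defs.v *)
From HB Require Import structures.
From mathcomp Require Import all_boot all_order all_algebra.
From mathcomp Require Import all_classical all_reals all_analysis.
Set Implicit Arguments. Unset Strict Implicit. Unset Printing Implicit Defensive.
Import Order.TTheory GRing.Theory Num.Theory.
Local Open Scope ring_scope.

(* k-choice model, for a fixed realisation z i n = Z^{(i)}_n (n >= 1, z >= 1).
   Tseq z f m lists the elements of T_m, computed with fuel f:
     T_m = {m}                                    if m <= 0,
     T_m = {m} U \bigcup_i T_(m - z i m)          if m >= 1.
   Since z >= 1, fuel f >= m is always enough; T_n := Tseq z n n. *)
Fixpoint Tseq (k : nat) (z : 'I_k -> nat -> nat) (fuel : nat) (m : int)
  : seq int :=
  match fuel with
  | 0%N => [:: m]
  | f.+1 =>
      if m <= 0 then [:: m]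
      else m :: flatten [seq Tseq z f (m - (z i `|m|%N)%:Z) | i <- enum 'I_k]
  end.

Definition Tn (k : nat) (z : 'I_k -> nat -> nat) (n : nat) : seq int :=
  Tseq z n n%:Z.

Definition leaves (k : nat) (z : 'I_k -> nat -> nat) (n : nat) : seq int :=
  [seq x <- Tn z n | x <= 0].

(* L_n = min calL_n (calL_n is nonempty and nonpositive, so starting
   the min-fold at 0 is harmless) *)
Definition Lmin (k : nat) (z : 'I_k -> nat -> nat) (n : nat) : int :=
  \big[Order.min/0]_(x <- leaves z n) x.

(* Main.v *)
(* Fix K and call m shallow if all leaves of T_m exceed -K; a vertex n >= 1 is shallow iff
   its k choices all are. Given the past, n is shallow with probability x_n^k, where
   x_n = sum_(b < n shallow) q_(n-b). The potential sum_(b <= n shallow) P(Z > n - b)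
   changes by 1_(n shallow) - x_n, so it is a nonnegative supermartingale and
   sum_n E(x_n - x_n^k) is finite. If n - 1 is shallow then x_n >= q_1, hence
   1 - x_n^k <= (k / q_1) (x_n - x_n^k): as k >= 2, the probabilities that n - 1 is shallow
   and n is not are summable. By Borel-Cantelli, almost surely either finitely many or all
   but finitely many vertices are shallow. The latter event is null: the expected potential
   is bounded, while on that event it tends to sum_j P(Z > j) = E Z = +oo. *)

Require Import Defs.
From HB Require Import structures.
From mathcomp Require Import all_boot all_order all_algebra.
From mathcomp Require Import all_classical all_reals all_analysis.
From mathcomp Require Import zify ring lra.
Import Order.TTheory GRing.Theory Num.Theory.
Local Open Scope classical_set_scope.
Local Open Scope ring_scope.

(** * Independence of the past from later choices *)

Section Independence.
Context {R : realType} {d : measure_display} {Omega : measurableType d}.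
Context (P : probability Omega R) {I : eqType} (X : I -> Omega -> nat).

Definition cyl (s : seq I) (v : I -> nat) : set Omega :=
  \big[setI/setT]_(p <- s) [set w | X p w = v p].

Lemma cylP (s : seq I) (v : I -> nat) (w : Omega) :
  cyl s v w <-> forall p, p \in s -> X p w = v p.
Proof.
rewrite /cyl; elim: s => [|a s IH].
  by rewrite big_nil; split.
rewrite big_cons; split.
  by move=> [/= wa /IH ws] p; rewrite inE => /predU1P[->|/ws].
move=> ws; split; first by apply: ws; rewrite mem_head.
by apply/IH => p ps; apply: ws; rewrite inE ps orbT.
Qed.

Definition past (Q : pred I) : set (set Omega) :=
  [set B | exists p v, Q p /\ B = [set w | X p w = v]].

Context {valid : pred I} {q : nat -> R}.
Context (mX : forall p v, measurable [set w | X p w = v]).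
Context (indep : forall (s : seq I) (v : I -> nat), uniq s -> all valid s ->
  P (cyl s v) = (\prod_(p <- s) q (v p))%:E).

Lemma measurable_cyl (s : seq I) (v : I -> nat) : measurable (cyl s v).
Proof. by rewrite /cyl; apply: bigsetI_measurable => p _; exact: mX. Qed.

Lemma measurable_past (Q : pred I) (A : set Omega) : <<s past Q>> A -> measurable A.
Proof.
move=> sA; apply: (sA); split; first exact: sigma_algebra_measurable.
by move=> _ [p [v [_ ->]]].
Qed.

(** Both sides are finite measures in [A]: [P] restricted to the cylinder, and a multiple of [P].
    They agree on cylinders over [Q], a pi-system that generates the past. *)
Lemma indep_past (Q : pred I) (t : seq I) (v : I -> nat) (A : set Omega) :
  (forall p, Q p -> valid p) -> uniq t -> all valid t -> all (predC Q) t ->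
  <<s past Q>> A -> P (A `&` cyl t v) = (P A * (\prod_(p <- t) q (v p))%:E)%E.
Proof.
move=> Qv ut vt Qt sA.
(* The empty set is included because cylinders with conflicting values are disjoint; otherwise a
   common point [w0] supplies the values of the intersection. *)
pose G : set (set Omega) := [set B | B = set0 \/
  exists s u, [/\ uniq s, all Q s & B = cyl s u]].
have mG : G `<=` measurable.
  by move=> _ [->|[s [u [_ _ ->]]]]; [exact: measurable0|exact: measurable_cyl].
have GI : setI_closed G.
  move=> B C [->|[s [u [us Qs ->]]]]; first by rewrite set0I; left.
  move=> [->|[s' [u' [us' Qs' ->]]]]; first by rewrite setI0; left.
  have [->|/set0P[w0 [/cylP w0s /cylP w0s']]] := eqVneq (cyl s u `&` cyl s' u') set0.
    by left.
  right; exists (undup (s ++ s')), (X^~ w0); split.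
  - exact: undup_uniq.
  - by rewrite all_undup all_cat Qs.
  - apply/seteqP; split=> w /=.
      move=> [/cylP ws /cylP ws']; apply/cylP => p.
      rewrite mem_undup mem_cat => /orP[ps|ps].
        by rewrite ws// w0s.
      by rewrite ws'// w0s'.
    move=> /cylP ws; split; apply/cylP => p ps.
      by rewrite ws ?w0s// mem_undup mem_cat ps.
    by rewrite ws ?w0s'// mem_undup mem_cat ps orbT.
have GT : G setT by right; exists [::], (fun=> 0%N); split => //; rewrite /cyl big_nil.
have sAG : <<s G>> A.
  apply: sA; split; first exact: smallest_sigma_algebra.
  move=> _ [p [n [Qp ->]]]; apply: sub_sigma_algebra; right.
  exists [:: p], (fun=> n); split => //=; first by rewrite Qp.
  by rewrite /cyl big_seq1.
have Ct := indep _ v ut vt.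
have c0 : (0 <= \prod_(p <- t) q (v p))%R by rewrite -lee_fin -Ct.
pose c : {nonneg R} := NngNum c0.
have -> : P (A `&` cyl t v) = mrestr P (measurable_cyl t v) A by [].
have -> : (P A * (\prod_(p <- t) q (v p))%:E)%E = mscale c P A by rewrite /mscale/= muleC.
apply: (@g_sigma_algebra_measure_unique _ _ _ G mG (fun=> setT)) => //.
- exact: bigcup_const.
- move=> _ [->|[s [u [us Qs ->]]]]; first by rewrite !measure0.
  rewrite /= /mrestr /mscale /= (indep _ u us); last exact: sub_all Qs.
  have dis p : p \in t -> p \notin s.
    by move=> pt; apply/negP => ps; have := allP Qt _ pt; rewrite /= (allP Qs _ ps).
  pose g p := if p \in s then u p else v p.
  have -> : cyl s u `&` cyl t v = cyl (s ++ t) g.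
    apply/seteqP; split=> w.
      move=> [/cylP ws /cylP wt]; apply/cylP => p; rewrite /g mem_cat.
      by case: ifPn => [/ws|] //= _ /wt.
    move=> /cylP wst; split; apply/cylP => p ps.
      by rewrite wst ?mem_cat ?ps// /g ps.
    by rewrite wst ?mem_cat ?ps ?orbT// /g (negbTE (dis _ ps)).
  rewrite indep ?cat_uniq ?all_cat ?us ?ut ?vt ?(sub_all Qv Qs)//; last first.
    by rewrite andbT /=; apply/hasPn.
  rewrite big_cat EFinM muleC; congr (_%:E * _%:E)%E.
    by apply: eq_big_seq => p pt; rewrite /g (negbTE (dis _ pt)).
  by apply: eq_big_seq => p pt; rewrite /g pt.
- move=> _; rewrite /= /mrestr setTI; exact: (le_lt_trans (probability_le1 _ (measurable_cyl _ _)) (ltry _)).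
Qed.

End Independence.

(** * Deterministic recursion for shallow vertices *)

Lemma all_flatten (T : Type) (a : pred T) (ss : seq (seq T)) :
  all a (flatten ss) = all (all a) ss.
Proof. by elim: ss => //= s ss IH; rewrite all_cat IH. Qed.

Section Threshold.
Context {k : nat} (z : 'I_k -> nat -> nat) (K : nat).
Hypothesis z_gt0 : forall j n, (0 < z j n)%N.

Lemma Tseq_le0 (f : nat) (m : int) : m <= 0 -> Tseq z f m = [:: m].
Proof. by case: f => //= f ->. Qed.

Lemma Tseq_fuel (f g : nat) (m : int) : m <= f%:Z -> m <= g%:Z -> Tseq z f m = Tseq z g m.
Proof.
elim: f g m => [|f IH] g m mf mg.
  by rewrite !Tseq_le0.
have [m0|m0] := leP m 0; first by rewrite !Tseq_le0.
case: g mg => [|g] mg; first by lia.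
rewrite /= leNgt m0 /=; congr (_ :: flatten _); apply: eq_map => j.
by have := z_gt0 j `|m|%N; move=> ?; apply: IH; lia.
Qed.

(* All leaves of T_(a - K) exceed -K; the index is shifted so that it is a natural number. *)
Definition shallow (a : nat) : bool :=
  all (fun x : int => - K%:Z < x) (Tseq z a (a%:Z - K%:Z)).

(** Index 0 is the vertex [-K]. Truncated subtraction also sends every vertex below [-K] there,
    consistently, as none of them is shallow. *)
Lemma shallow0 : shallow 0 = false.
Proof. by rewrite /shallow /= andbT sub0r ltxx. Qed.

Lemma shallow_small (a : nat) : (0 < a <= K)%N -> shallow a.
Proof. by move=> aK; rewrite /shallow Tseq_le0 /= ?andbT; lia. Qed.

Lemma shallow_rec (n : nat) : (0 < n)%N ->
  shallow (n + K) = [forall j, shallow (n + K - z j n)].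
Proof.
move=> n0; rewrite /shallow PoszD addrK addnC.
case: n n0 => // n _; rewrite addnS /=.
have -> /= : - K%:Z < n.+1%:Z by lia.
rewrite all_flatten all_map; apply/allP/forallP => [h j|h j _].
- have := h j (mem_enum _ j) => /=.
  have zj := z_gt0 j n.+1; have [zn|zn] := leqP (z j n.+1) (n.+1 + K).
    by rewrite (@Tseq_fuel _ ((K + n).+1 - z j n.+1)); [congr all; congr Tseq| |]; lia.
  by rewrite Tseq_le0 /=; lia.
- have := h j => /=.
  have zj := z_gt0 j n.+1; have [zn|zn] := leqP (z j n.+1) (n.+1 + K).
    by rewrite (@Tseq_fuel (K + n) ((K + n).+1 - z j n.+1)); [congr all; congr Tseq| |]; lia.
  by rewrite [X in Tseq _ X _](_ : _ = 0%N) /=; lia.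
Qed.

(** An element of the tree that is at most [-K] is nonpositive, hence among the leaves. *)
Lemma Lmin_le_shallow (n : nat) : ~~ shallow (n + K) -> Lmin z n <= - K%:Z.
Proof.
rewrite /shallow PoszD addrK (@Tseq_fuel _ n); [|lia|lia].
move=> /allPn[x xT]; rewrite -leNgt => xK; apply: le_trans (xK).
have : x \in leaves z n by rewrite mem_filter xT andbT; lia.
rewrite /Lmin; elim: (leaves z n) => // y s IH; rewrite inE big_cons ge_min.
by case/predU1P => [->|/IH ->]; rewrite ?lexx ?orbT.
Qed.

End Threshold.

(** * Tail sums and the mean *)

Section Summation.
Context {R : realType} (q : nat -> R).

(** P(Z > j) for the law [q], written with a finite sum to keep the algebra elementary. *)
Definition tail (j : nat) : R := 1 - \sum_(0 <= v < j.+1) q v.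

Lemma tailS (j : nat) : tail j.+1 = tail j - q j.+1.
Proof. by rewrite /tail (big_nat_recr j.+1)//= opprD addrA. Qed.

(** Abel summation: the truncated form of sum_j P(Z > j) = E Z, with its boundary term. *)
Lemma sum_tail (J : nat) :
  \sum_(0 <= j < J) tail j = \sum_(0 <= v < J.+1) v%:R * q v + J%:R * tail J.
Proof.
elim: J => [|J IH]; first by rewrite big_nil big_nat1 !mul0r addr0.
by rewrite big_nat_recr//= IH (big_nat_recr J.+1)//= tailS -natr1; ring.
Qed.

Lemma nneseries_le (u : nat -> R) (B : R) (m : nat) :
  (forall i, (m <= i)%N -> 0 <= u i) -> (forall N, \sum_(m <= i < N) u i <= B) ->
  (\sum_(m <= i <oo) (u i)%:E <= B%:E)%E.
Proof.
move=> u0 uB; apply: lime_le.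
  by apply: is_cvg_nneseries => i mi _; rewrite lee_fin u0.
by apply: nearW => N; rewrite sumEFin lee_fin.
Qed.

(** The boundary term in [sum_tail] is nonnegative, so a bound on the tail sums would bound the
    partial sums of E Z. *)
Lemma sum_tail_unbounded :
  (forall i, 0 <= q i) -> (forall j, 0 <= tail j) ->
  (\sum_(1 <= i <oo) (i%:R * q i)%:E = +oo)%E ->
  forall B : R, exists J : nat, B < \sum_(0 <= j < J) tail j.
Proof.
move=> q0 t0 EZ B; apply: contrapT => /forallNP h.
have : (\sum_(1 <= i <oo) (i%:R * q i)%:E <= B%:E)%E.
  apply: nneseries_le => [i _|N]; first by rewrite mulr_ge0.
  case: N => [|N].
    by rewrite big_geq//; have /negP := h 0%N; rewrite big_nil -leNgt.
  have /negP := h N; rewrite -leNgt sum_tail; apply: le_trans.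
  by rewrite (@big_ltn _ _ _ 0)//= mul0r add0r lerDl mulr_ge0.
by rewrite EZ leye_eq.
Qed.

End Summation.

(** * Shallow events and the history of a vertex *)

Section ChoiceModel.
Context {R : realType} {d : measure_display} {Omega : measurableType d}.
Context (P : probability Omega R) {k : nat} (Z : 'I_k -> nat -> Omega -> nat).
Context (q : nat -> R) (K : nat).
Hypothesis k_ge2 : (2 <= k)%N.
Hypothesis Z_gt0 : forall j n w, (0 < Z j n w)%N.
Hypothesis mZ : forall j n v, measurable [set w | Z j n w = v].
Hypothesis indepZ : forall (s : seq ('I_k * nat)) (v : 'I_k * nat -> nat),
  uniq s -> all (fun p => (0 < p.2)%N) s ->
  P (\big[setI/setT]_(p <- s) [set w | Z p.1 p.2 w = v p])
    = (\prod_(p <- s) q (v p))%:E.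

Local Notation X := (fun p : 'I_k * nat => Z p.1 p.2).
Local Notation shallow_at w := (shallow (fun j m => Z j m w) K).
Local Notation pr A := (fine (P A)).

Definition before (n : nat) : pred ('I_k * nat) := [pred p | (0 < p.2 < n)%N].

Definition shallow_event (a : nat) : set Omega := [set w | shallow_at w a].

Definition shallow_choice (j : 'I_k) (n : nat) : set Omega :=
  [set w | shallow_at w (n + K - Z j n w)].

Local Notation E := shallow_event.
Local Notation C := shallow_choice.
Local Notation history n := (<<s past X (before n) >>).

Lemma prE (A : set Omega) : measurable A -> P A = (pr A)%:E.
Proof. by move=> mA; rewrite fineK// fin_num_measure. Qed.

Lemma ler_pr (A B : set Omega) : measurable A -> measurable B -> A `<=` B -> pr A <= pr B.
Proof.
by move=> mA mB AB; rewrite -lee_fin -!prE// le_measure ?inE.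
Qed.

Lemma prD (A B : set Omega) : measurable A -> measurable B ->
  pr (A `\` B) = pr A - pr (A `&` B).
Proof.
move=> mA mB; apply: EFin_inj; rewrite EFinB -!prE//.
- by rewrite measureD// ltey_eq fin_num_measure.
- exact: measurableI.
- exact: measurableD.
Qed.

Lemma shallow_event0 : E 0 = set0.
Proof. by apply/seteqP; split => w //=; rewrite /shallow_event/= shallow0. Qed.

Lemma shallow_eventE (n : nat) : (0 < n)%N -> E (n + K) = \bigcap_j C j n.
Proof.
move=> n0; apply/seteqP; split => w; rewrite /shallow_event /shallow_choice /=.
  by rewrite shallow_rec// => /forallP h j _; exact: h.
by move=> h; rewrite shallow_rec//; apply/forallP => j; exact: (h j).
Qed.

Lemma shallow_choiceE (j : 'I_k) (n : nat) :
  C j n = \bigcup_v ([set w | Z j n w = v] `&` E (n + K - v)).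
Proof.
apply/seteqP; split => w; rewrite /shallow_choice/=; first by exists (Z j n w).
by move=> [v _ [/= ->]].
Qed.

(** Indices below [n + K] are vertices below [n], whose trees use only choices made before [n]. *)
Lemma history_shallow (n a : nat) : (a < n + K)%N -> history n (E a).
Proof.
elim/ltn_ind: a => a IH aK.
pose T := g_sigma_algebraType (past X (before n)).
change (measurable (E a : set T)).
have [a0|a0] := posnP a; first by rewrite a0 shallow_event0; exact: measurable0.
have [aK'|Ka] := leqP a K.
  rewrite (_ : E a = setT); first exact: measurableT.
  by apply/seteqP; split => w //= _; rewrite /shallow_event/= shallow_small ?a0.
have [m m0 am] : exists2 m, (0 < m)%N & a = (m + K)%N by exists (a - K)%N; lia.
rewrite am shallow_eventE//.
apply: (@fin_bigcap_measurable _ T) => [|j _]; first exact: finite_finset.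
(* The value 0 would not lower the index, so it is set apart; its event is empty. *)
rewrite shallow_choiceE; apply: bigcupT_measurable => -[|v].
  rewrite (_ : _ `&` _ = set0); first exact: measurable0.
  by apply/seteqP; split => w //= -[] Z0; have := Z_gt0 j m w; rewrite Z0.
apply: measurableI; last by apply: IH; lia.
apply: sub_sigma_algebra; exists (j, m), v.+1; split => //.
by rewrite /before inE/=; lia.
Qed.

Lemma measurable_shallow (a : nat) : measurable (E a).
Proof.
apply: (measurable_past X (fun p => mZ p.1 p.2)).
by apply: (@history_shallow a.+1); lia.
Qed.

Lemma measurable_choice (j : 'I_k) (n : nat) : measurable (C j n).
Proof.
rewrite shallow_choiceE; apply: bigcupT_measurable => v.
by apply: measurableI => //; exact: measurable_shallow.
Qed.

Lemma q_ge0 (v : nat) : 0 <= q v.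
Proof.
have j : 'I_k by exact: (Ordinal (ltnW k_ge2)).
have := indepZ [:: (j, 1%N)] (fun=> v) isT isT.
by rewrite !big_seq1/= -lee_fin => <-.
Qed.

Lemma q0 : q 0 = 0.
Proof.
have j : 'I_k by exact: (Ordinal (ltnW k_ge2)).
have := indepZ [:: (j, 1%N)] (fun=> 0%N) isT isT.
rewrite !big_seq1/= (_ : [set _ | _] = set0) ?measure0; first by case.
by apply/seteqP; split => w //= Z0; have := Z_gt0 j 1 w; rewrite Z0.
Qed.

Lemma tail_ge0 (i : nat) : 0 <= tail q i.
Proof.
have j : 'I_k by exact: (Ordinal (ltnW k_ge2)).
pose F (v : nat) := [set w | Z j 1 w = v].
rewrite subr_ge0 -lee_fin -(@probability_setT _ _ _ P) -sumEFin.
rewrite (eq_bigr (fun v => P (F v))); last first.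
  move=> v _; have := indepZ [:: (j, 1%N)] (fun=> v) isT isT.
  by rewrite !big_seq1.
rewrite big_mkord -measure_bigsetU_ord//=.
- by apply: le_measure; rewrite ?inE//; apply: bigsetU_measurable => v _; exact: mZ.
- by move=> v; exact: mZ.
- by apply/trivIsetP => u v _ _ uv; apply/seteqP; split => w //=; rewrite /F/= => -[-> /val_inj/eqP]; rewrite (negbTE uv).
Qed.

(* The terms v = 0 and v = n + K vanish, since q 0 = 0 and E 0 is empty. *)
Definition mean_shallow (n : nat) (A : set Omega) : R :=
  \sum_(0 <= v < (n + K).+1) q v * pr (A `&` E (n + K - v)).

(** Split by the value [u] of the choice: for [u > 0], [A] and [E (n + K - u)] belong to the history
    of [n], so [indep_past] factors off [Z j n] and [t] together. The list [t] allows another choice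
    of the same vertex to be prescribed. *)
Lemma pr_choice (n : nat) (A : set Omega) (j : 'I_k) (t : seq ('I_k * nat))
    (v : 'I_k * nat -> nat) :
  (0 < n)%N -> history n A -> uniq ((j, n) :: t) -> all (fun p => (n <= p.2)%N) t ->
  pr (A `&` cyl X t v `&` C j n) = (\prod_(p <- t) q (v p)) * mean_shallow n A.
Proof.
move=> n0 hA /= /andP[jt ut] nt.
have mA : measurable A by exact: measurable_past X (fun p => mZ p.1 p.2) _ _ hA.
have mt : measurable (cyl X t v) by exact: measurable_cyl (fun p => mZ p.1 p.2) _ _.
pose F (u : nat) := (A `&` E (n + K - u)) `&` ([set w | Z j n w = u] `&` cyl X t v).
have mF u : measurable (F u).
  by do 2 apply: measurableI => //; exact: measurable_shallow.
(* Values above [n + K] lead to index 0, which is not shallow, so finitely many pieces suffice. *)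
have -> : A `&` cyl X t v `&` C j n = \big[setU/set0]_(u < (n + K).+1) F u.
  rewrite -(bigcup_mkord _ F); apply/seteqP; split => w; rewrite /shallow_choice/=.
    move=> [[Aw tw] sw]; exists (Z j n w) => //=.
    rewrite ltnS leqNgt; apply/negP => nK; move: sw.
    by rewrite (_ : (_ - _)%N = 0%N) ?shallow0//; lia.
  by move=> [u _ [[Aw Ew] [/= -> tw]]].
apply: EFin_inj; rewrite -prE; last by apply: bigsetU_measurable => u _.
rewrite measure_bigsetU_ord//; last first.
  apply/trivIsetP => a b _ _ ab; apply/seteqP; split => w //=.
  by rewrite /F/= => -[[_ [-> _]] [_ [/val_inj/eqP]]]; rewrite (negbTE ab).
rewrite mulr_sumr big_mkord -sumEFin; apply: eq_bigr => -[[|u] uK] _ /=.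
  (* [E (n + K)] need not belong to the history of [n], but the value 0 never occurs. *)
  rewrite q0 mul0r mulr0 (_ : F 0%N = set0) ?measure0//.
  by apply/seteqP; split => w //= -[_ [Z0 _]]; have := Z_gt0 j n w; rewrite Z0.
pose v' p := if p == (j, n) then u.+1 else v p.
have v't : {in t, v' =1 v}.
  by move=> p pt; rewrite /v'; case: eqP => // pj; rewrite -pj pt in jt.
have -> : F u.+1 = (A `&` E (n + K - u.+1)) `&` cyl X ((j, n) :: t) v'.
  rewrite /F; congr setI; rewrite /cyl big_cons; congr setI.
    by rewrite /v' eqxx.
  by apply: eq_big_seq => p pt; rewrite v't.
have hAE : history n (A `&` E (n + K - u.+1)).
  pose T := g_sigma_algebraType (past X (before n)).
  change (measurable (A `&` E (n + K - u.+1) : set T)).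
  by apply: measurableI => //; apply: history_shallow; lia.
rewrite (indep_past P X (fun p => mZ p.1 p.2) indepZ (before n) _ _ _ _ _ _ _ hAE)//.
- rewrite big_cons {1}/v' eqxx prE; last exact: measurableI _ (measurable_shallow _).
  rewrite -EFinM; congr EFin.
  rewrite (eq_big_seq (fun p => q (v p))); first by ring.
  by move=> p pt; rewrite v't.
- by move=> p /andP[].
- by rewrite /= jt.
- by rewrite /= n0; apply: sub_all nt => p; exact: leq_trans.
- rewrite /before /= ltnn andbF/=; apply: sub_all nt => p /=; lia.
Qed.

(** * Drift and potential *)

(** For [n >= 1] this is E(x_n - x_n^k): a given choice is shallow with probability E(x_n), the
    vertex itself with probability E(x_n^k). *)
Definition drift (n : nat) : R := mean_shallow n setT - pr (E (n + K)).

Lemma history_setT (n : nat) : history n setT.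
Proof. exact: (@measurableT _ (g_sigma_algebraType (past X (before n)))). Qed.

Lemma pr_choice1 (n : nat) (A : set Omega) (j : 'I_k) :
  (0 < n)%N -> history n A -> pr (A `&` C j n) = mean_shallow n A.
Proof.
move=> n0 hA; have := @pr_choice n A j [::] (fun=> 0%N) n0 hA isT isT.
by rewrite /cyl !big_nil setIT mul1r.
Qed.

Lemma drift_leaves (n : nat) (j : 'I_k) : (0 < n)%N -> drift n = pr (C j n `\` E (n + K)).
Proof.
move=> n0; rewrite prD; [|exact: measurable_choice|exact: measurable_shallow].
rewrite setIidr; last by rewrite shallow_eventE// => w; apply.
by rewrite -[X in pr X - _]setTI pr_choice1//; exact: history_setT.
Qed.

Lemma drift_ge0 (n : nat) : (0 < n)%N -> 0 <= drift n.
Proof. by move=> n0; rewrite (drift_leaves _ (Ordinal k_ge2))// fine_ge0. Qed.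

(** A union bound reduces the transition to one given choice not being shallow. Prescribing the
    value 1 for another choice, at cost [q 1], then yields a vertex with one shallow and one
    non-shallow choice, an event whose probability is at most the drift. *)
Lemma transition_le_drift (n : nat) : (0 < n)%N ->
  q 1 * pr (E (n + K).-1 `\` E (n + K)) <= k%:R * drift n.
Proof.
move=> n0; set A := E (n + K).-1.
have hA : history n A by apply: history_shallow; lia.
have mA : measurable A by exact: measurable_shallow.
have mE : measurable (E (n + K)) by exact: measurable_shallow.
have mAC j : measurable (A `\` C j n) by apply: measurableD => //; exact: measurable_choice.
(* By symmetry P(A `\` C j n) does not depend on j. *)
have union : pr (A `\` E (n + K)) <= k%:R * (pr A - mean_shallow n A).
  rewrite -lee_fin -prE; last exact: measurableD.
  apply: (@le_trans _ _ (\sum_(j < k) P (A `\` C j n))%E).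
    (* Extends the family over the choices by the empty set to all naturals, the form used for
       finite subadditivity. *)
    pose F i := if insub i is Some j then A `\` C j n else set0.
    have Fj (j : 'I_k) : F j = A `\` C j n by rewrite /F valK.
    rewrite (eq_bigr (fun j : 'I_k => P (F j))); last by move=> j _; rewrite Fj.
    apply: content_subadditive => //; first by move=> i ik; rewrite -[i]/(val (Ordinal ik)) Fj.
      exact: measurableD.
    rewrite -(bigcup_mkord k F) shallow_eventE// => w [Aw].
    move=> /existsNP[j nCj]; exists (val j); first exact: ltn_ord.
    by rewrite Fj; split => // Cj; apply: nCj.
  rewrite (eq_bigr (fun=> (pr A - mean_shallow n A)%:E)); last first.
    by move=> j _; rewrite prE// prD ?pr_choice1//; exact: measurable_choice.
  by rewrite sumEFin lee_fin sumr_const card_ord mulr_natl.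
apply: le_trans (ler_wpM2l (q_ge0 1) union) _.
rewrite mulrCA; apply: ler_wpM2l => //.
pose j0 : 'I_k := Ordinal (ltnW k_ge2); pose j1 : 'I_k := Ordinal k_ge2.
(* [j0] is pinned to the shallow vertex [n - 1] while [j1] stays free to fail; two distinct choices
   exist since [2 <= k]. *)
pose B := A `&` cyl X [:: (j0, n)] (fun=> 1%N).
have mB : measurable B.
  by apply: measurableI => //; exact: measurable_cyl (fun p => mZ p.1 p.2) _ _.
have -> : q 1 * (pr A - mean_shallow n A) = pr (B `\` C j1 n).
  rewrite prD//; last exact: measurable_choice.
  rewrite pr_choice//= ?leqnn//.
  rewrite mulrBr big_seq1; congr (_ - _); apply: EFin_inj; rewrite -prE//.
  rewrite /B (indep_past P X (fun p => mZ p.1 p.2) indepZ (before n))//.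
  - by rewrite big_seq1 [P A]prE// muleC.
  - by move=> p /andP[].
  - by rewrite /= n0.
  - by rewrite /before /= ltnn andbF.
rewrite (drift_leaves _ j0)//; apply: ler_pr.
- by apply: measurableD => //; exact: measurable_choice.
- by apply: measurableD => //; exact: measurable_choice.
move=> w [[Aw /cylP Zw] nC1]; split.
  have := Zw _ (mem_head _ _); rewrite /shallow_choice/= => ->.
  by rewrite subn1.
by rewrite shallow_eventE// => /(_ j1 I).
Qed.

(* Expected number, for a fixed j, of vertices n > N whose j-th choice is a shallow vertex
   of index at most N. *)
Definition potential (N : nat) : R :=
  \sum_(0 <= j < (N + K).+1) pr (E (N + K - j)) * tail q j.

(** The weights lost by the old vertices, [tail j - tail j.+1 = q j.+1], add up to [mean_shallow];
    the new vertex enters with weight [tail 0 = 1]. *)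
Lemma potentialS (N : nat) : potential N.+1 = potential N - drift N.+1.
Proof.
rewrite /potential addSn big_nat_recl// subn0 /drift /mean_shallow addSn.
rewrite (big_nat_recl (N + K).+1)//= q0 mul0r add0r opprB addrCA -sumrB.
congr (_ + _); first by rewrite /tail big_nat1 q0 subr0 mulr1.
apply: eq_bigr => j _; rewrite subSS setTI tailS; ring.
Qed.

Lemma potential_drift (N : nat) :
  \sum_(0 <= n < N) drift n.+1 + potential N = potential 0.
Proof.
elim: N => [|N IH]; first by rewrite big_nil add0r.
by rewrite big_nat_recr//= potentialS -addrA addrCA addrC -IH; ring.
Qed.

Lemma potential_ge0 (N : nat) : 0 <= potential N.
Proof. by apply: sumr_ge0 => j _; rewrite mulr_ge0 ?tail_ge0 ?fine_ge0. Qed.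

(** * Almost sure behaviour for one threshold *)

Lemma ae_no_transition : 0 < q 1 ->
  {ae P, forall w, exists N, forall a, (N <= a)%N -> E a w -> E a.+1 w}.
Proof.
move=> q1.
pose F n := E (n + K) `\` E (n + K).+1.
have mF n : measurable (F n) by apply: measurableD; exact: measurable_shallow.
have F0 : P (lim_sup_set F) = 0%E.
  apply: lim_sup_set_cvg0 => //.
  rewrite (eq_eseriesr (g := fun n => (pr (F n))%:E)); last by move=> n _; rewrite -prE.
  (* The total drift is at most [potential 0], and each transition has probability at most [k / q 1]
     times its drift. *)
  apply: (@le_lt_trans _ _ ((k%:R * potential 0 / q 1)%:E)%E); last exact: ltry.
  apply: nneseries_le => [n _|N]; first exact: fine_ge0.
  rewrite ler_pdivlMr// mulrC mulr_sumr.
  apply: (@le_trans _ _ (\sum_(0 <= n < N) k%:R * drift n.+1)).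
    by apply: ler_sum => n _; exact: (@transition_le_drift n.+1).
  rewrite -mulr_sumr; apply: ler_wpM2l => //.
  by rewrite -(potential_drift N) lerDl potential_ge0.
have mL : measurable (lim_sup_set F).
  by apply: bigcapT_measurable => n; apply: bigcup_measurable => i _; exact: mF.
exists (lim_sup_set F); split => // w /= nw; apply: contrapT => nL; apply: nw.
have [n Hn] : exists n, forall i, (n <= i)%N -> ~ F i w.
  apply: contrapT => /forallNP h; apply: nL => n _.
  apply: contrapT => h'; apply: (h n) => i ni Fi; apply: h'.
  by exists i.
exists (n + K)%N => a na Ea; apply: contrapT => nE.
apply: (Hn (a - K)%N); first by lia.
by rewrite /F subnK//; lia.
Qed.

(** The potential stays below [potential 0], yet dominates P(F) times tail sums that are unbounded;
    hence P(F) = 0. *)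
Lemma ae_not_cofinite (N0 : nat) :
  (\sum_(1 <= i <oo) (i%:R * q i)%:E = +oo)%E ->
  {ae P, forall w, exists2 a, (N0 <= a)%N & ~ E a w}.
Proof.
move=> EZ; pose F := \bigcap_(a in [set a | (N0 <= a)%N]) E a.
have mF : measurable F.
  by apply: bigcap_measurableType => a _; exact: measurable_shallow.
exists F; split => //; last first.
  move=> w /= nw a /= Na; apply: contrapT => nE; apply: nw; by exists a.
rewrite prE//; congr EFin; apply/eqP; rewrite eq_le fine_ge0// andbT leNgt; apply/negP => F0.
have [J] := sum_tail_unbounded q q_ge0 tail_ge0 EZ (potential 0 / pr F).
rewrite ltr_pdivrMr// ltNge => /negP; apply.
apply: (@le_trans _ _ (potential (J + N0))); last first.
  rewrite -(potential_drift (J + N0)) lerDr sumr_ge0// => n _.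
  exact: drift_ge0.
(* For [j < J] the index [J + N0 + K - j] is at least [N0], so its event contains [F]; the remaining
   terms are nonnegative. *)
rewrite /potential [leRHS](big_cat_nat (n := J))//=; last by lia.
rewrite mulr_suml -[leLHS]addr0; apply: lerD; last first.
  by apply: sumr_ge0 => j _; rewrite mulr_ge0 ?tail_ge0 ?fine_ge0.
rewrite !big_nat; apply: ler_sum => j jJ; rewrite mulrC ler_wpM2r ?tail_ge0//.
apply: ler_pr => //; first exact: measurable_shallow.
by apply: bigcap_inf => /=; lia.
Qed.

(** Once transitions have ceased, a single shallow vertex would make all later ones shallow,
    although non-shallow ones occur arbitrarily late. *)
Lemma ae_eventually_not_shallow : 0 < q 1 ->
  (\sum_(1 <= i <oo) (i%:R * q i)%:E = +oo)%E ->
  {ae P, forall w, exists N, forall n, (N <= n)%N -> Lmin (fun j m => Z j m w) n <= - K%:Z}.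
Proof.
move=> q1 EZ.
have H1 := ae_no_transition q1.
have H2 := ae_foralln (fun N0 => ae_not_cofinite N0 EZ).
apply: filterS2 H1 H2 => w [N tr] nE; exists N => n Nn.
apply: Lmin_le_shallow => [j m|]; first exact: Z_gt0.
apply/negP => En; have [a na] := nE (n + K)%N; apply.
rewrite -(subnK na) addnC; elim: (a - (n + K))%N => [|i IH]; first by rewrite addn0.
by rewrite addnS; apply: tr => //; lia.
Qed.

End ChoiceModel.

(** * All thresholds together *)

Theorem mainTheorem12 (R : realType) (d : measure_display)
  (Omega : measurableType d) (P : probability Omega R)
  (k : nat) (Z : 'I_k -> nat -> Omega -> nat) (q : nat -> R) :
  (2 <= k)%N ->
  (* Z takes values in N = {1,2,...} *)
  (forall j n w, (0 < Z j n w)%N) ->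
  (forall j n v, measurable [set w | Z j n w = v]) ->
  (* the Z^{(j)}_n (j < k, n >= 1) are mutually independent, each with law q *)
  (forall (s : seq ('I_k * nat)) (v : 'I_k * nat -> nat),
      uniq s -> all (fun p => (0 < p.2)%N) s ->
      P (\big[setI/setT]_(p <- s) [set w | Z p.1 p.2 w = v p])
        = (\prod_(p <- s) q (v p))%:E) ->
  (forall i, (0 < i)%N -> 0 < q i) ->
  (\sum_(1 <= i <oo) (i%:R * q i)%:E = +oo)%E ->
  {ae P, forall w, forall M : int, exists N : nat,
      forall n, (N <= n)%N -> Lmin (fun j m => Z j m w) n <= M}.
Proof.
move=> k_ge2 Z_gt0 mZ indepZ q_gt0 EZ.
(* Countably many thresholds [K] share one null set, and [K = |M|] serves [M] because
   [-|M| <= M]. *)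
have H := ae_foralln (fun K =>
  ae_eventually_not_shallow P Z q K k_ge2 Z_gt0 mZ indepZ (q_gt0 1%N isT) EZ).
apply: filterS H => w Hw M; have [N HN] := Hw `|M|%N.
by exists N => n /HN Ln; apply: le_trans Ln _; lia.
Qed.
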